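(* Let $B$ be a bialgebra in $\mathcal C$. The following conditions are equivalent. 1. $B$ is isomorphic, as a bialgebra, to a normalized cross product bialgebra on a tensor product $B_1\otimes B_2$. 2. There are idempotents $\Pi_1,\Pi_2\in\mathrm{End}(B)$ such that $$\mathrm m_B\circ(\Pi_1\otimes\Pi_1)=\Pi_1\circ\mathrm m_B\circ(\Pi_1\otimes\Pi_1),\qquad \Pi_1\circ\eta_B=\eta_B,$$ $$(\Pi_2\otimes\Pi_2)\circ\Delta_B=(\Pi_2\otimes\Pi_2)\circ\Delta_B\circ\Pi_2,\qquad \varepsilon_B\circ\Pi_2=\varepsilon_B,$$ and the sequence $B\otimes B\xrightarrow{\ \mathrm m_B\circ(\Pi_1\otimes\Pi_2)\ }B\xrightarrow{\ (\Pi_1\otimes\Pi_2)\circ\Delta_B\ }B\otimes B$ is a splitting of the idempotent $\Pi_1\otimes\Pi_2$ of $B\otimes B$. 3. There are objects $B_1$ (an algebra) and $B_2$ (a coalgebra) and morphisms $B_1\xrightarrow{\mathrm i_1}B\xrightarrow{\mathrm p_1}B_1$ and $B_2\xrightarrow{\mathrm i_2}B\xrightarrow{\mathrm p_2}B_2$, where $\mathrm i_1$ is an algebra morphism, $\mathrm p_2$ is a coalgebra morphism and $\mathrm p_j\circ\mathrm i_j=\mathrm{id}_{B_j}$ for $j\in\{1,2\}$, such that $\mathrm m_B\circ(\mathrm i_1\otimes\mathrm i_2):B_1\otimes B_2\to B$ and $(\mathrm p_1\otimes\mathrm p_2)\circ\Delta_B:B\to B_1\otimes B_2$ are mutually inverse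 isomorphisms.
   Context: $\mathcal C$ is a strict braided monoidal category with tensor product $\otimes$, unit object $\mathbb 1$ and braiding $\Psi$, in which idempotents split. Algebras $(\mathrm m,\eta)$, coalgebras $(\Delta,\varepsilon)$ and bialgebras are taken in $\mathcal C$; in a bialgebra, $\Delta_B\circ\mathrm m_B=(\mathrm m_B\otimes\mathrm m_B)\circ(\mathrm{id}\otimes\Psi_{B,B}\otimes\mathrm{id})\circ(\Delta_B\otimes\Delta_B)$, $\Delta_B\eta_B=\eta_B\otimes\eta_B$, $\varepsilon_B\mathrm m_B=\varepsilon_B\otimes\varepsilon_B$, $\varepsilon_B\eta_B=\mathrm{id}_{\mathbb 1}$. ''$X\otimes X\xrightarrow{p}Y\xrightarrow{i}X\otimes X$ is a splitting of the idempotent $\Pi$'' means $p\circ i=\mathrm{id}_Y$ and $i\circ p=\Pi$. Cross product algebra: let $(B_1,\mathrm m_1,\eta_1)$ be an algebra, $B_2$ an object, and $\eta_2:\mathbb 1\to B_2$, $\varphi_{2,1}:B_2\otimes B_1\to B_1\otimes B_2$, $\hat\sigma:B_2\otimes B_2\to B_1\otimes B_2$ morphisms with $\varphi_{2,1}=(\mathrm m_1\otimes\mathrm{id}_{B_2})\circ(\mathrm{id}_{B_1}\otimes\hat\sigma)\circ(\varphi_{2,1}\otimes\eta_2)$. If $B_1\otimes B_2$ is an algebra with multiplication $(\mathrm m_1\otimes\mathrm{id}_{B_2})\circ(\mathrm m_1\otimes\hat\sigma)\circ(\mathrm{id}_{B_1}\otimes\varphi_{2,1}\otimes\mathrm{id}_{B_2})$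 and unit $\eta_1\otimes\eta_2$, it is called a cross product algebra. Cross product coalgebra: let $(B_2,\Delta_2,\varepsilon_2)$ be a coalgebra, $B_1$ an object, and $\varepsilon_1:B_1\to\mathbb 1$, $\varphi_{1,2}:B_1\otimes B_2\to B_2\otimes B_1$, $\hat\rho:B_1\otimes B_2\to B_1\otimes B_1$ morphisms with $\varphi_{1,2}=(\varepsilon_1\otimes\varphi_{1,2})\circ(\hat\rho\otimes\mathrm{id}_{B_2})\circ(\mathrm{id}_{B_1}\otimes\Delta_2)$. If $B_1\otimes B_2$ is a coalgebra with comultiplication $(\mathrm{id}_{B_1}\otimes\varphi_{1,2}\otimes\mathrm{id}_{B_2})\circ(\hat\rho\otimes\Delta_2)\circ(\mathrm{id}_{B_1}\otimes\Delta_2)$ and counit $\varepsilon_1\otimes\varepsilon_2$, it is called a cross product coalgebra. Cross product bialgebra: a bialgebra whose underlying algebra is a cross product algebra and whose underlying coalgebra is a cross product coalgebra on the same objects $B_1,B_2$. It is called normalized if $\varepsilon_1\circ\eta_1=\mathrm{id}_{\mathbb 1}$ (equivalently $\varepsilon_2\circ\eta_2=\mathrm{id}_{\mathbb 1}$). *)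

(* Defs.v *)
Set Implicit Arguments.
Unset Strict Implicit.
Unset Printing Implicit Defensive.

Declare Scope obj_scope.
Declare Scope mor_scope.
Delimit Scope obj_scope with obj.
Delimit Scope mor_scope with mor.
Open Scope mor_scope.

Reserved Notation "A ~> B" (at level 60, no associativity).
Reserved Notation "x ⊗ y" (at level 40, left associativity).
Reserved Notation "g ∘ f" (at level 50, left associativity).
Reserved Notation "f ≡ g" (at level 70, no associativity).

Record Category := {
  ob :> Type;
  hom : ob -> ob -> Type;
  idm : forall A : ob, hom A A;
  comp : forall A B D : ob, hom B D -> hom A B -> hom A D;
  comp_idl : forall (A B : ob) (f : hom A B), comp (idm B) f = f;
  comp_idr : forall (A B : ob) (f : hom A B), comp f (idm A) = f;
  compA : forall (A B D E : ob) (h : hom D E) (g : hom B D) (f : hom A B),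
    comp h (comp g f) = comp (comp h g) f
}.
Arguments hom {c} A%_obj B%_obj.
Arguments idm {c} A%_obj.
Arguments comp {c A B D} g%_mor f%_mor.
Bind Scope obj_scope with ob.
Bind Scope mor_scope with hom.

Notation "A ~> B" := (hom A B) : type_scope.
Notation "'id[' A ]" := (idm A) (at level 0, format "'id[' A ]") : mor_scope.

(* Transport of a morphism along equalities of its source and its target. In a
   strict monoidal category this is how a morphism is read with a different
   bracketing of its source and target. *)
Definition hom_cast (C : Category) (A A' B B' : C) (f : A ~> B)
    (eA : A = A') (eB : B = B') : A' ~> B' :=
  match eA in _ = X, eB in _ = Y return X ~> Y with
  | eq_refl, eq_refl => f
  end.
Arguments hom_cast {C A A' B B'} & f%_mor eA eB.

Definition comp_cast (C : Category) (A B B' D : C) (g : B' ~> D) (f : A ~> B)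
    (e : B = B') : A ~> D :=
  comp g (hom_cast f eq_refl e).
Arguments comp_cast {C A B B' D} g%_mor f%_mor e.

Definition eq_cast (C : Category) (A A' B B' : C) (f : A ~> B) (g : A' ~> B')
    (eA : A = A') (eB : B = B') : Prop :=
  hom_cast f eA eB = g.
Arguments eq_cast {C A A' B B'} f%_mor g%_mor eA eB.

(* Mac Lane's definition: the bifunctor is associative and unital on objects
   and on arrows. *)
Record StrictMonoidalCategory := {
  smc_cat :> Category;
  tens : smc_cat -> smc_cat -> smc_cat;
  tunit : smc_cat;
  tensm : forall A A' B B' : smc_cat,
    A ~> A' -> B ~> B' -> tens A B ~> tens A' B';
  tensm_id : forall A B : smc_cat, tensm (idm A) (idm B) = idm (tens A B);
  tensm_comp : forall (A A' A'' B B' B'' : smc_cat)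
      (f : A ~> A') (f' : A' ~> A'') (g : B ~> B') (g' : B' ~> B''),
    tensm (comp f' f) (comp g' g) = comp (tensm f' g') (tensm f g);
  tensA : forall A B D : smc_cat, tens A (tens B D) = tens (tens A B) D;
  tens1l : forall A : smc_cat, tens tunit A = A;
  tens1r : forall A : smc_cat, tens A tunit = A;
  tensmA : forall (A A' B B' D D' : smc_cat)
      (f : A ~> A') (g : B ~> B') (h : D ~> D'),
    hom_cast (tensm f (tensm g h)) (tensA A B D) (tensA A' B' D')
      = tensm (tensm f g) h;
  tensm1l : forall (A A' : smc_cat) (f : A ~> A'),
    hom_cast (tensm (idm tunit) f) (tens1l A) (tens1l A') = f;
  tensm1r : forall (A A' : smc_cat) (f : A ~> A'),
    hom_cast (tensm f (idm tunit)) (tens1r A) (tens1r A') = f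
}.
Arguments tens {s} A%_obj B%_obj.
Arguments tunit {s}.
Arguments tensm {s A A' B B'} f%_mor g%_mor.

Notation "A ⊗ B" := (tens A B) : obj_scope.
Notation "'𝟙'" := tunit : obj_scope.
Notation "f ⊗ g" := (tensm f g) : mor_scope.

(* Equality of two tensor words that differ by bracketing and units only. *)
Ltac strict_eq :=
  first [ reflexivity | rewrite ?tensA, ?tens1l, ?tens1r; reflexivity ].

(* Composition, equality and ascription of morphisms up to the identifications
   (A ⊗ B) ⊗ D = A ⊗ (B ⊗ D) and 𝟙 ⊗ A = A = A ⊗ 𝟙; the object equality is found
   by [strict_eq]. When no identification is needed, "∘" is [comp] and "≡" is "="
   by computation. *)
Notation "g ∘ f" := (comp_cast g f ltac:(strict_eq))
  (only parsing) : mor_scope.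
Notation "f ≡ g" := (eq_cast f g ltac:(strict_eq) ltac:(strict_eq))
  (only parsing) : type_scope.
Notation "⌜ f ⌝" := (hom_cast f ltac:(strict_eq) ltac:(strict_eq))
  (at level 0, f at level 200, only parsing) : mor_scope.
Notation "g ∘ f" := (comp_cast g f _) (only printing) : mor_scope.
Notation "f ≡ g" := (eq_cast f g _ _) (only printing) : type_scope.
Notation "⌜ f ⌝" := (hom_cast f _ _)
  (at level 0, f at level 200, only printing) : mor_scope.

Definition inverse_morphisms (C : Category) (A B : C) (f : A ~> B) (g : B ~> A) :=
  g ∘ f = id[A] /\ f ∘ g = id[B].

Definition is_iso (C : Category) (A B : C) (f : A ~> B) :=
  exists g : B ~> A, inverse_morphisms f g.

Definition idempotent (C : Category) (A : C) (e : A ~> A) := e ∘ e = e.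

(* A --p--> Y --i--> A is a splitting of e. *)
Definition is_splitting (C : Category) (A Y : C)
    (p : A ~> Y) (i : Y ~> A) (e : A ~> A) :=
  p ∘ i = id[Y] /\ i ∘ p = e.

Definition idempotents_split (C : Category) :=
  forall (A : C) (e : A ~> A), idempotent e ->
    exists (Y : C) (p : A ~> Y) (i : Y ~> A), is_splitting p i e.

Record StrictBraidedCategory := {
  sbc_cat :> StrictMonoidalCategory;
  braid : forall A B : sbc_cat, (A ⊗ B)%obj ~> (B ⊗ A)%obj;
  braid_iso : forall A B : sbc_cat, is_iso (braid A B);
  braid_nat : forall (A A' B B' : sbc_cat) (f : A ~> A') (g : B ~> B'),
    braid A' B' ∘ (f ⊗ g) = (g ⊗ f) ∘ braid A B;
  braid_tensr : forall A B D : sbc_cat,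
    braid A (B ⊗ D)%obj ≡ (id[B] ⊗ braid A D) ∘ (braid A B ⊗ id[D]);
  braid_tensl : forall A B D : sbc_cat,
    braid (A ⊗ B)%obj D ≡ (braid A D ⊗ id[B]) ∘ (id[A] ⊗ braid B D)
}.
Arguments braid {s} A%_obj B%_obj.


Section Algebras.
Variable C : StrictBraidedCategory.
Implicit Types A B : C.

Record is_algebra A (m : A ⊗ A ~> A) (eta : 𝟙 ~> A) : Prop := {
  alg_assoc : m ∘ (m ⊗ id[A]) ≡ m ∘ (id[A] ⊗ m);
  alg_unitl : m ∘ (eta ⊗ id[A]) ≡ id[A];
  alg_unitr : m ∘ (id[A] ⊗ eta) ≡ id[A]
}.

Record is_coalgebra A (delta : A ~> A ⊗ A) (eps : A ~> 𝟙) : Prop := {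
  coalg_coassoc : (delta ⊗ id[A]) ∘ delta ≡ (id[A] ⊗ delta) ∘ delta;
  coalg_counitl : (eps ⊗ id[A]) ∘ delta ≡ id[A];
  coalg_counitr : (id[A] ⊗ eps) ∘ delta ≡ id[A]
}.

Record algebra_on A := {
  mul : A ⊗ A ~> A;
  eta : 𝟙 ~> A;
  algebra_axioms : is_algebra mul eta
}.

Record coalgebra_on A := {
  comul : A ~> A ⊗ A;
  eps : A ~> 𝟙;
  coalgebra_axioms : is_coalgebra comul eps
}.

Definition algebra_morphism A A' (a : algebra_on A) (a' : algebra_on A')
    (f : A ~> A') :=
  f ∘ mul a = mul a' ∘ (f ⊗ f) /\ f ∘ eta a = eta a'.

Definition coalgebra_morphism A A' (c : coalgebra_on A) (c' : coalgebra_on A')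
    (f : A ~> A') :=
  (f ⊗ f) ∘ comul c = comul c' ∘ f /\ eps c' ∘ f = eps c.

Record is_bialgebra A (a : algebra_on A) (c : coalgebra_on A) : Prop := {
  bialg_comul_mul :
    comul c ∘ mul a
      = (mul a ⊗ mul a) ∘ (id[A] ⊗ braid A A ⊗ id[A]) ∘ (comul c ⊗ comul c);
  bialg_comul_unit : comul c ∘ eta a ≡ eta a ⊗ eta a;
  bialg_counit_mul : eps c ∘ mul a ≡ eps c ⊗ eps c;
  bialg_counit_unit : eps c ∘ eta a = id[𝟙]
}.

Record Bialgebra := {
  bialg_ob :> C;
  bialg_alg :> algebra_on bialg_ob;
  bialg_coalg :> coalgebra_on bialg_ob;
  bialgebra_axioms : is_bialgebra bialg_alg bialg_coalg
}.

Definition bialgebra_isomorphic (H K : Bialgebra) :=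
  exists f : H ~> K,
    is_iso f /\ algebra_morphism H K f /\ coalgebra_morphism H K f.

Section CrossProductAlgebra.
Variables B1 B2 : C.

Definition cross_mul (m1 : B1 ⊗ B1 ~> B1) (phi21 : B2 ⊗ B1 ~> B1 ⊗ B2)
    (sigma : B2 ⊗ B2 ~> B1 ⊗ B2) : (B1 ⊗ B2) ⊗ (B1 ⊗ B2) ~> B1 ⊗ B2 :=
  ⌜ (m1 ⊗ id[B2]) ∘ (m1 ⊗ sigma) ∘ (id[B1] ⊗ phi21 ⊗ id[B2]) ⌝.

Record CrossProductAlgebra := {
  cpa_alg1 : algebra_on B1;
  cpa_unit2 : 𝟙 ~> B2;
  cpa_phi21 : B2 ⊗ B1 ~> B1 ⊗ B2;
  cpa_sigma : B2 ⊗ B2 ~> B1 ⊗ B2;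
  cpa_phi21E :
    cpa_phi21 ≡ (mul cpa_alg1 ⊗ id[B2]) ∘ (id[B1] ⊗ cpa_sigma)
                  ∘ (cpa_phi21 ⊗ cpa_unit2);
  cpa_axioms : is_algebra (cross_mul (mul cpa_alg1) cpa_phi21 cpa_sigma)
                          ⌜ eta cpa_alg1 ⊗ cpa_unit2 ⌝
}.

Definition cross_algebra (X : CrossProductAlgebra) : algebra_on (B1 ⊗ B2) :=
  {| algebra_axioms := cpa_axioms X |}.

Definition cross_comul (delta2 : B2 ~> B2 ⊗ B2) (phi12 : B1 ⊗ B2 ~> B2 ⊗ B1)
    (rho : B1 ⊗ B2 ~> B1 ⊗ B1) : B1 ⊗ B2 ~> (B1 ⊗ B2) ⊗ (B1 ⊗ B2) :=
  ⌜ (id[B1] ⊗ phi12 ⊗ id[B2]) ∘ (rho ⊗ delta2) ∘ (id[B1] ⊗ delta2) ⌝.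

Record CrossProductCoalgebra := {
  cpc_coalg2 : coalgebra_on B2;
  cpc_counit1 : B1 ~> 𝟙;
  cpc_phi12 : B1 ⊗ B2 ~> B2 ⊗ B1;
  cpc_rho : B1 ⊗ B2 ~> B1 ⊗ B1;
  cpc_phi12E :
    cpc_phi12 ≡ (cpc_counit1 ⊗ cpc_phi12) ∘ (cpc_rho ⊗ id[B2])
                  ∘ (id[B1] ⊗ comul cpc_coalg2);
  cpc_axioms : is_coalgebra (cross_comul (comul cpc_coalg2) cpc_phi12 cpc_rho)
                            ⌜ cpc_counit1 ⊗ eps cpc_coalg2 ⌝
}.

Definition cross_coalgebra (X : CrossProductCoalgebra) :
    coalgebra_on (B1 ⊗ B2) :=
  {| coalgebra_axioms := cpc_axioms X |}.

End CrossProductAlgebra.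

Record CrossProductBialgebra := {
  cpb_ob1 : C;
  cpb_ob2 : C;
  cpb_alg : CrossProductAlgebra cpb_ob1 cpb_ob2;
  cpb_coalg : CrossProductCoalgebra cpb_ob1 cpb_ob2;
  cpb_axioms : is_bialgebra (cross_algebra cpb_alg) (cross_coalgebra cpb_coalg)
}.

Definition cpb_bialgebra (X : CrossProductBialgebra) : Bialgebra :=
  {| bialgebra_axioms := cpb_axioms X |}.

Definition normalized (X : CrossProductBialgebra) :=
  cpc_counit1 (cpb_coalg X) ∘ eta (cpa_alg1 (cpb_alg X)) = id[𝟙].

End Algebras.

Coercion cpb_bialgebra : CrossProductBialgebra >-> Bialgebra.

(* Main.v *)
From Stdlib Require Import ClassicalEpsilon Eqdep.
Require Import Defs.

Set Implicit Arguments.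
Unset Strict Implicit.
Unset Printing Implicit Defensive.

(** A normalized cross product bialgebra on [B1 ⊗ B2] comes with the four maps
    [i1 = id ⊗ η2], [i2 = η1 ⊗ id], [p1 = id ⊗ ε2] and [p2 = ε1 ⊗ id], and for
    these [m (i1 ⊗ i2)] and [(p1 ⊗ p2) Δ] are both the identity.  So a cross
    product is a bialgebra that factors, both as an algebra and as a coalgebra,
    through a subalgebra [B1] and a quotient coalgebra [B2].  The theorem says
    that such a factorization is all that is needed, and that it may be recorded
    either by the split maps [i1, p1, i2, p2] or by the idempotents [i1 p1] and
    [i2 p2].

    From idempotents to split maps and back: a split monomorphism [i] with
    retraction [p] is an algebra morphism for some algebra structure on its source
    exactly when the idempotent [i p] is closed under products and the unit
    ([subalgebra_iff_closed]), and [m (P1 ⊗ P2)], [(P1 ⊗ P2) Δ] split [P1 ⊗ P2]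
    exactly when [m (i1 ⊗ i2)], [(p1 ⊗ p2) Δ] are inverse to each other
    ([splitting_iff_inverse]).

    From split maps to a cross product: write [f • g = m (f ⊗ g)] for two
    morphisms into an algebra; this product is associative and unital.  Put
    [φ = i1 • i2], an isomorphism, and define [φ21] and [σ] by [φ φ21 = i2 • i1]
    and [φ σ = i2 • i2].  Since [i1] is an algebra morphism, [φ] turns the left
    action of [B1] on [B1 ⊗ B2] and the right multiplication by [B2] into [•], so
    the cross product multiplication becomes [i1 • (i2 • i1) • i2 = φ • φ]: it is
    the multiplication of [B] transported along [φ]
    ([cross_algebra_of_factorization]).  The unit of [B2] is [p2 η], and
    [i2 p2 η = η] because [η = φ φ⁻¹ η] ([unit_of_complement]).

    From a cross product to split maps: the unit law and the normalization of
    [φ21] together force [φ21 (η2 ⊗ id) = id ⊗ η2] ([phi21_unit]), and everything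
    about [i1] and [i2] follows from that.

    The coalgebra half of each step is its algebra half read in the category with
    arrows and tensor factors reversed, with [B1] and [B2] exchanged
    ([oprev], [op_cross_product], [cross_coalgebra_of_op]).

    Associativity of the tensor product is an equality of objects, so equations
    between morphisms carry transports.  They are removed by passing to [arrow]:
    a morphism bundled with its source and target, where two morphisms that
    differ by a transport become equal and [⊠] is associative on the nose. *)

(** * Arrows: morphisms up to transport *)

Record arrow (C : Category) := Arr { src : C; tgt : C; mor : src ~> tgt }.
Arguments Arr {C src tgt} mor%_mor.

Notation "« f »" := (Arr f) (at level 0, f at level 200) : mor_scope.

(** Composition is made total so that arrows can be rewritten freely; on arrows
    that do not compose the value [g] is arbitrary, with the merit that the
    target of [g ∙ f] is always that of [g]. *)
Definition acomp (C : Category) (g f : arrow C) : arrow C :=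
  match excluded_middle_informative (tgt f = src g) with
  | left e => « comp_cast (mor g) (mor f) e »
  | right _ => g
  end.
Arguments acomp {C} g f : simpl never.

Definition atens (C : StrictMonoidalCategory) (f g : arrow C) : arrow C :=
  « mor f ⊗ mor g ».

Notation "g ∙ f" := (acomp g f) (at level 50, left associativity) : mor_scope.
Notation "f ⊠ g" := (atens f g) (at level 40, left associativity) : mor_scope.

Section Arrows.
Context {C : Category}.

(** Nothing is lost by bundling: the loops of object equalities that relate two
    bundled morphisms of the same type are trivial. *)
Lemma Arr_inj (A B : C) (f g : A ~> B) : « f » = « g » -> f = g.
Proof.
intros e.
exact (inj_pairT2 _ _ _ _ _ (inj_pairT2 _ _ _ _ _
  (f_equal (fun a => existT (fun A => {B : C & A ~> B}) (src a)
                       (existT _ (tgt a) (mor a))) e))).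
Qed.

Lemma Arr_eta (f : arrow C) : « mor f » = f.
Proof. now destruct f. Qed.

Lemma Arr_hom_cast (A A' B B' : C) (f : A ~> B) (eA : A = A') (eB : B = B') :
  « hom_cast f eA eB » = « f ».
Proof. now destruct eA, eB. Qed.

Lemma Arr_comp_cast (A B B' D : C) (g : B' ~> D) (f : A ~> B) (e : B = B') :
  « comp_cast g f e » = « g » ∙ « f ».
Proof.
unfold acomp; simpl.
destruct (excluded_middle_informative (B = B')) as [e'|ne]; [|now destruct ne].
now rewrite (proof_irrelevance _ e e').
Qed.

Lemma Arr_comp (A B D : C) (g : B ~> D) (f : A ~> B) :
  « comp g f » = « g » ∙ « f ».
Proof. exact (Arr_comp_cast g f eq_refl). Qed.

Lemma ArrE (A B : C) (f g : A ~> B) : f = g <-> « f » = « g ».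
Proof. split; [now intros -> | apply Arr_inj]. Qed.

Lemma eq_castE (A A' B B' : C) (f : A ~> B) (g : A' ~> B')
    (eA : A = A') (eB : B = B') : eq_cast f g eA eB <-> « f » = « g ».
Proof.
unfold eq_cast; destruct eA, eB; simpl; split; [now intros -> | apply Arr_inj].
Qed.

Lemma tgt_acomp (g f : arrow C) : tgt (g ∙ f) = tgt g.
Proof. unfold acomp; now destruct excluded_middle_informative. Qed.

Lemma src_acomp (g f : arrow C) : tgt f = src g -> src (g ∙ f) = src f.
Proof. unfold acomp; now destruct excluded_middle_informative. Qed.

Lemma acompA (h g f : arrow C) :
  tgt f = src g -> tgt g = src h -> h ∙ (g ∙ f) = h ∙ g ∙ f.
Proof.
destruct h as [D E h], g as [B D' g], f as [A B' f]; simpl.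
intros -> ->; rewrite <- !Arr_comp; f_equal; apply compA.
Qed.

Lemma acomp_idl (A : C) (f : arrow C) : tgt f = A -> « id[A] » ∙ f = f.
Proof.
destruct f as [A' B f]; simpl; intros ->.
rewrite <- Arr_comp; f_equal; apply comp_idl.
Qed.

Lemma acomp_idr (A : C) (f : arrow C) : src f = A -> f ∙ « id[A] » = f.
Proof.
destruct f as [A' B f]; simpl; intros ->.
rewrite <- Arr_comp; f_equal; apply comp_idr.
Qed.

(** Equalities into the source of a split monomorphism are tested after it; this
    is how structures are transported below. *)
Lemma acomp_cancel (A B : C) (f : A ~> B) (g : B ~> A) (x y : arrow C) :
  g ∘ f = id[A] -> tgt x = A -> tgt y = A -> « f » ∙ x = « f » ∙ y -> x = y.
Proof.
intros gf xA yA exy.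
assert (e : « g » ∙ « f » = « id[A] ») by (rewrite <- Arr_comp; f_equal; exact gf).
rewrite <- (acomp_idl xA), <- (acomp_idl yA), <- e, <- !acompA by easy.
now rewrite exy.
Qed.

End Arrows.

Section MonoidalArrows.
Context {C : StrictMonoidalCategory}.

Lemma Arr_tensm (A A' B B' : C) (f : A ~> A') (g : B ~> B') :
  « f ⊗ g » = « f » ⊠ « g ».
Proof. reflexivity. Qed.

Lemma atensA (f g h : arrow C) : f ⊠ (g ⊠ h) = f ⊠ g ⊠ h.
Proof. unfold atens; simpl; now rewrite <- tensmA, Arr_hom_cast. Qed.

Lemma atens1l (f : arrow C) : « id[𝟙] » ⊠ f = f.
Proof.
unfold atens; simpl.
now rewrite <- (Arr_hom_cast _ (tens1l _) (tens1l _)), tensm1l, Arr_eta.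
Qed.

Lemma atens1r (f : arrow C) : f ⊠ « id[𝟙] » = f.
Proof.
unfold atens; simpl.
now rewrite <- (Arr_hom_cast _ (tens1r _) (tens1r _)), tensm1r, Arr_eta.
Qed.

Lemma atens_id (A B : C) : « id[A] » ⊠ « id[B] » = « id[A ⊗ B] ».
Proof. unfold atens; simpl; now rewrite tensm_id. Qed.

Lemma atens_comp (f f' g g' : arrow C) :
  tgt f = src f' -> tgt g = src g' ->
  (f' ⊠ g') ∙ (f ⊠ g) = (f' ∙ f) ⊠ (g' ∙ g).
Proof.
destruct f as [A A' f], f' as [A2 A'' f'], g as [B B' g], g' as [B2 B'' g'].
simpl; intros <- <-; unfold atens; simpl.
rewrite <- !Arr_comp; simpl; now rewrite tensm_comp.
Qed.

(** * Products of arrows into an algebra *)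

Definition times (A : C) (m : A ⊗ A ~> A) (f g : arrow C) : arrow C :=
  « m » ∙ (f ⊠ g).

(** [lact] is the left action of the algebra [B1] on the free module [B1 ⊗ B2],
    applied to two arrows; [ract] is multiplication of [B1 ⊗ B2] by [B2] on the
    right, as dictated by [sigma].  The cross product multiplication is assembled
    from the two in [cross_mulE]. *)
Definition lact (B1 B2 : C) (m1 : B1 ⊗ B1 ~> B1) (f g : arrow C) : arrow C :=
  (« m1 » ⊠ « id[B2] ») ∙ (f ⊠ g).

Definition ract (B1 B2 : C) (m1 : B1 ⊗ B1 ~> B1) (sigma : B2 ⊗ B2 ~> B1 ⊗ B2)
    (g h : arrow C) : arrow C :=
  lact B2 m1 (« id[B1] ») (« sigma ») ∙ (g ⊠ h).

Lemma tgt_times (A : C) (m : A ⊗ A ~> A) (f g : arrow C) :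
  tgt (times m f g) = A.
Proof. apply tgt_acomp. Qed.

Lemma src_times (A : C) (m : A ⊗ A ~> A) (f g : arrow C) :
  tgt f = A -> tgt g = A -> src (times m f g) = (src f ⊗ src g)%obj.
Proof. now intros fA gA; unfold times; rewrite src_acomp; simpl; rewrite ?fA, ?gA. Qed.

Lemma tgt_lact (B1 B2 : C) (m1 : B1 ⊗ B1 ~> B1) (f g : arrow C) :
  tgt (lact B2 m1 f g) = (B1 ⊗ B2)%obj.
Proof. apply tgt_acomp. Qed.

Lemma src_lact (B1 B2 : C) (m1 : B1 ⊗ B1 ~> B1) (f g : arrow C) :
  tgt f = B1 -> tgt g = (B1 ⊗ B2)%obj ->
  src (lact B2 m1 f g) = (src f ⊗ src g)%obj.
Proof.
intros fB gB; unfold lact; rewrite src_acomp; [reflexivity|].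
now simpl; rewrite fB, gB, tensA.
Qed.

Lemma tgt_ract (B1 B2 : C) (m1 : B1 ⊗ B1 ~> B1) (sigma : B2 ⊗ B2 ~> B1 ⊗ B2)
    (g h : arrow C) : tgt (ract m1 sigma g h) = (B1 ⊗ B2)%obj.
Proof. unfold ract; rewrite tgt_acomp; apply tgt_lact. Qed.

Lemma src_ract (B1 B2 : C) (m1 : B1 ⊗ B1 ~> B1) (sigma : B2 ⊗ B2 ~> B1 ⊗ B2)
    (g h : arrow C) : tgt g = (B1 ⊗ B2)%obj -> tgt h = B2 ->
  src (ract m1 sigma g h) = (src g ⊗ src h)%obj.
Proof.
intros gB hB; unfold ract; rewrite src_acomp; [reflexivity|].
rewrite src_lact by reflexivity; simpl; now rewrite gB, hB, tensA.
Qed.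

End MonoidalArrows.

(* Decides that a source and a target agree up to bracketing and units. *)
Ltac typed :=
  repeat first
    [ rewrite tgt_acomp | rewrite tgt_times | rewrite tgt_lact | rewrite tgt_ract
    | rewrite src_acomp by typed | rewrite src_times by typed
    | rewrite src_lact by typed | rewrite src_ract by typed
    | match goal with H : tgt _ = _ |- _ => rewrite H end
    | progress simpl ];
  rewrite ?tensA, ?tens1l, ?tens1r; reflexivity.

Ltac to_arrows :=
  repeat first [ rewrite eq_castE | rewrite Arr_hom_cast
               | rewrite Arr_comp_cast | rewrite Arr_comp | rewrite Arr_tensm ].

Ltac to_arrows_in H :=
  repeat first [ rewrite eq_castE in H | rewrite Arr_hom_cast in H
               | rewrite Arr_comp_cast in H | rewrite Arr_comp in H
               | rewrite Arr_tensm in H ].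

Lemma times_comp (C : StrictMonoidalCategory) (A : C) (m : A ⊗ A ~> A)
    (f g x y : arrow C) :
  tgt f = A -> tgt g = A -> tgt x = src f -> tgt y = src g ->
  times m f g ∙ (x ⊠ y) = times m (f ∙ x) (g ∙ y).
Proof.
intros fA gA xf yg; unfold times.
rewrite <- acompA, atens_comp by typed; reflexivity.
Qed.

Section Algebra.
Context {C : StrictBraidedCategory} {A : C} (a : algebra_on A).

Notation "f • g" := (times (mul a) f g) (at level 45, left associativity).

(** With associativity of [m] absorbed here, computations in an algebra become
    computations in a monoid, graded by the sources of the arrows. *)
Lemma timesA (f g h : arrow C) :
  tgt f = A -> tgt g = A -> tgt h = A -> f • (g • h) = f • g • h.
Proof.
intros fA gA hA; unfold times.
pose proof (alg_assoc (algebra_axioms a)) as e; to_arrows_in e.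
transitivity (« mul a » ∙ (« id[A] » ⊠ « mul a ») ∙ (f ⊠ (g ⊠ h))).
- rewrite <- acompA, atens_comp, acomp_idl by typed; reflexivity.
- rewrite <- e, atensA, <- acompA, atens_comp, acomp_idl by typed; reflexivity.
Qed.

Lemma times1l (f : arrow C) : tgt f = A -> « eta a » • f = f.
Proof.
intros fA; unfold times.
pose proof (alg_unitl (algebra_axioms a)) as e; to_arrows_in e.
transitivity (« mul a » ∙ (« eta a » ⊠ « id[A] ») ∙ (« id[𝟙] » ⊠ f)).
- rewrite <- acompA, atens_comp, acomp_idl, acomp_idr by typed; reflexivity.
- now rewrite e, atens1l, acomp_idl by typed.
Qed.

Lemma times1r (f : arrow C) : tgt f = A -> f • « eta a » = f.
Proof.
intros fA; unfold times.
pose proof (alg_unitr (algebra_axioms a)) as e; to_arrows_in e.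
transitivity (« mul a » ∙ (« id[A] » ⊠ « eta a ») ∙ (f ⊠ « id[𝟙] »)).
- rewrite <- acompA, atens_comp, acomp_idl, acomp_idr by typed; reflexivity.
- now rewrite e, atens1r, acomp_idl by typed.
Qed.

Lemma morphism_times (A' : C) (m' : A' ⊗ A' ~> A') (i : A' ~> A)
    (f g : arrow C) :
  i ∘ m' = mul a ∘ (i ⊗ i) -> tgt f = A' -> tgt g = A' ->
  « i » ∙ times m' f g = (« i » ∙ f) • (« i » ∙ g).
Proof.
intros e fA gA; apply (f_equal (@Arr C _ _)) in e; to_arrows_in e.
unfold times; rewrite acompA, e, <- acompA, atens_comp by typed; reflexivity.
Qed.

(** The axioms may be checked after the monomorphism [f], where they are those of
    [a].  A retraction suffices, so this covers subalgebras as well as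
    isomorphisms. *)
Lemma is_algebra_along_split_mono (A' : C) (m' : A' ⊗ A' ~> A') (eta' : 𝟙 ~> A')
    (f : A' ~> A) (g : A ~> A') :
  g ∘ f = id[A'] -> f ∘ m' = mul a ∘ (f ⊗ f) -> f ∘ eta' = eta a ->
  is_algebra m' eta'.
Proof.
intros gf fm fe.
pose proof (f_equal (@Arr C _ _) fe) as fe'; to_arrows_in fe'.
split; to_arrows; apply (acomp_cancel gf); try typed.
- change (« f » ∙ times m' (« m' ») (« id[A'] »)
          = « f » ∙ times m' (« id[A'] ») (« m' »)).
  rewrite !(morphism_times fm), acomp_idr by typed.
  assert (e : « f » ∙ « m' » = « f » • « f »)
    by now rewrite <- Arr_comp_cast with (e := eq_refl), fm; to_arrows.
  rewrite e, timesA by typed; reflexivity.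
- change (« f » ∙ times m' (« eta' ») (« id[A'] ») = « f » ∙ « id[A'] »).
  rewrite (morphism_times fm), fe', acomp_idr, times1l by typed; reflexivity.
- change (« f » ∙ times m' (« id[A'] ») (« eta' ») = « f » ∙ « id[A'] »).
  rewrite (morphism_times fm), fe', acomp_idr, times1r by typed; reflexivity.
Qed.

End Algebra.

Notation "f •[ a ] g" := (times (mul a) f g)
  (at level 45, left associativity) : mor_scope.

(** * The cross product multiplication *)

Section CrossProduct.
Context {C : StrictBraidedCategory} {B1 B2 : C}.
Variables (a1 : algebra_on B1) (sigma : B2 ⊗ B2 ~> B1 ⊗ B2).

Notation "f ▷ g" := (lact B2 (mul a1) f g) (at level 46, right associativity).
Notation "g ◁ h" := (ract (mul a1) sigma g h) (at level 45, left associativity).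

Lemma lact_comp (f g x y : arrow C) :
  tgt f = B1 -> tgt g = (B1 ⊗ B2)%obj -> tgt x = src f -> tgt y = src g ->
  (f ▷ g) ∙ (x ⊠ y) = (f ∙ x) ▷ (g ∙ y).
Proof.
intros fB gB xf yg; unfold lact.
rewrite <- acompA, atens_comp by typed; reflexivity.
Qed.

Lemma ract_comp (g h x y : arrow C) :
  tgt g = (B1 ⊗ B2)%obj -> tgt h = B2 -> tgt x = src g -> tgt y = src h ->
  (g ◁ h) ∙ (x ⊠ y) = (g ∙ x) ◁ (h ∙ y).
Proof.
intros gB hB xg yh; unfold ract.
rewrite <- acompA, atens_comp by typed; reflexivity.
Qed.

Lemma lact_tens (f x y : arrow C) : tgt f = B1 -> tgt x = B1 -> tgt y = B2 ->
  f ▷ (x ⊠ y) = (f •[a1] x) ⊠ y.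
Proof.
intros fB xB yB; unfold lact.
rewrite atensA, atens_comp, acomp_idl by typed; reflexivity.
Qed.

Lemma lact1 (g : arrow C) : tgt g = (B1 ⊗ B2)%obj -> « eta a1 » ▷ g = g.
Proof.
intros gB.
transitivity ((« eta a1 » ▷ (« id[B1] » ⊠ « id[B2] »)) ∙ (« id[𝟙] » ⊠ g)).
- rewrite lact_comp, acomp_idr, atens_id, acomp_idl by typed; reflexivity.
- rewrite lact_tens, times1l, atens1l, atens_id, acomp_idl by typed; reflexivity.
Qed.

(** By naturality it is enough to see this for [h = id ⊗ id], where it is
    associativity of [B1]. *)
Lemma lactA (f g h : arrow C) :
  tgt f = B1 -> tgt g = B1 -> tgt h = (B1 ⊗ B2)%obj ->
  f ▷ (g ▷ h) = (f •[a1] g) ▷ h.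
Proof.
intros fB gB hB.
assert (eh : « id[B1] » ⊠ « id[B2] » ∙ h = h)
  by now rewrite atens_id, acomp_idl.
rewrite <- eh.
transitivity ((f ▷ (g ▷ (« id[B1] » ⊠ « id[B2] »)))
                ∙ (« id[src f] » ⊠ (« id[src g] » ⊠ h))).
- rewrite lact_tens by typed.
  rewrite (lact_comp (g := (g •[a1] « id[B1] ») ⊠ « id[B2] »)) by typed.
  rewrite acomp_idr, <- (lact_tens (x := « id[B1] »)) by typed.
  rewrite lact_comp, acomp_idr by typed; reflexivity.
- rewrite !lact_tens, timesA, atensA by typed.
  rewrite <- (lact_tens (x := « id[B1] »)) by typed.
  rewrite (atens_id (src f)), lact_comp by typed.
  rewrite acomp_idr by typed; reflexivity.
Qed.

(** The formula [b1 ▷ (φ21 (b2 ⊗ b1') ◁ b2')] for the product of [b1 ⊗ b2] and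
    [b1' ⊗ b2']: commute [b2] past [b1'], then multiply in from both sides. *)
Lemma cross_mulE (phi : B2 ⊗ B1 ~> B1 ⊗ B2) :
  « cross_mul (mul a1) phi sigma » = « id[B1] » ▷ (« phi » ◁ « id[B2] »).
Proof.
assert (e1 : « id[B1] » •[a1] « id[B1] » = « mul a1 »)
  by (unfold times; rewrite atens_id, acomp_idr by typed; reflexivity).
unfold ract.
rewrite <- (acomp_idr (A := B1) (f := « id[B1] »)) at 1 by typed.
rewrite <- lact_comp, lactA, e1, atensA by typed.
unfold cross_mul, lact; to_arrows; reflexivity.
Qed.

End CrossProduct.

(** * From a factorization to a cross product algebra *)

Section Factorization.
Context {C : StrictBraidedCategory} {A B1 B2 : C}.
Variables (a : algebra_on A) (a1 : algebra_on B1).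
Variables (i1 : B1 ~> A) (i2 : B2 ~> A).
Hypothesis i1_mul : i1 ∘ mul a1 = mul a ∘ (i1 ⊗ i1).
Hypothesis i1_eta : i1 ∘ eta a1 = eta a.

Variable phi : B1 ⊗ B2 ~> A.
Hypothesis phiE : phi = mul a ∘ (i1 ⊗ i2).

Lemma Arr_phi : « phi » = « i1 » •[a] « i2 ».
Proof. rewrite phiE; to_arrows; reflexivity. Qed.

(** [i1] respects products, so [φ = i1 • i2] is a morphism of left
    [B1]-modules. *)
Lemma phi_lact (f g : arrow C) : tgt f = B1 -> tgt g = (B1 ⊗ B2)%obj ->
  « phi » ∙ lact B2 (mul a1) f g = (« i1 » ∙ f) •[a] (« phi » ∙ g).
Proof.
intros fB gB.
assert (e : « phi » ∙ (« mul a1 » ⊠ « id[B2] ») = « i1 » •[a] « phi »).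
{ rewrite Arr_phi, times_comp, acomp_idr, timesA by typed.
  now rewrite <- Arr_comp_cast with (e := eq_refl), i1_mul; to_arrows. }
unfold lact; rewrite acompA, e by typed.
rewrite times_comp by typed; reflexivity.
Qed.

Lemma phi_ract (sigma : B2 ⊗ B2 ~> B1 ⊗ B2) (g h : arrow C) :
  « phi » ∙ « sigma » = « i2 » •[a] « i2 » ->
  tgt g = (B1 ⊗ B2)%obj -> tgt h = B2 ->
  « phi » ∙ ract (mul a1) sigma g h = (« phi » ∙ g) •[a] (« i2 » ∙ h).
Proof.
intros e gB hB.
unfold ract; rewrite acompA, phi_lact, e by typed.
rewrite acomp_idr, timesA, <- Arr_phi by typed.
rewrite times_comp by typed; reflexivity.
Qed.

(** Under the isomorphism [φ] both required equations become identities between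
    products: the cross product multiplication goes to [i1 • (i2 • i1) • i2], and
    the normalization of [φ21] reads [i2 • i1 = i2 • i1 • η]. *)
Lemma cross_algebra_of_factorization (eta2 : 𝟙 ~> B2) :
  i2 ∘ eta2 = eta a -> is_iso phi ->
  exists X : CrossProductAlgebra B1 B2,
    cpa_alg1 X = a1 /\ cpa_unit2 X = eta2 /\
    algebra_morphism (cross_algebra X) a phi.
Proof.
intros i2_eta phi_iso.
destruct (phi_iso) as [psi [psi_phi phi_psi]].
apply (f_equal (@Arr C _ _)) in phi_psi; rewrite Arr_comp_cast in phi_psi.
pose (phi21 := psi ∘ (mul a ∘ (i2 ⊗ i1))).
pose (sigma := psi ∘ (mul a ∘ (i2 ⊗ i2))).
assert (phi_phi21 : « phi » ∙ « phi21 » = « i2 » •[a] « i1 »).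
{ unfold phi21; rewrite Arr_comp_cast, acompA, phi_psi, acomp_idl by typed.
  to_arrows; reflexivity. }
assert (phi_sigma : « phi » ∙ « sigma » = « i2 » •[a] « i2 »).
{ unfold sigma; rewrite Arr_comp_cast, acompA, phi_psi, acomp_idl by typed.
  to_arrows; reflexivity. }
apply (f_equal (@Arr C _ _)) in i1_eta, i2_eta; to_arrows_in i1_eta; to_arrows_in i2_eta.
assert (phi_mul : phi ∘ cross_mul (mul a1) phi21 sigma = mul a ∘ (phi ⊗ phi)).
{ apply Arr_inj; rewrite Arr_comp_cast, cross_mulE.
  rewrite phi_lact, (phi_ract phi_sigma), phi_phi21, !acomp_idr by typed.
  rewrite !timesA, <- timesA, <- !Arr_phi by typed.
  rewrite Arr_comp_cast; reflexivity. }
(* Stated for every identification of [𝟙 ⊗ 𝟙] with [𝟙], so that it applies to the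
   one chosen in the definition of cross products. *)
assert (phi_eta : forall eA eB, phi ∘ hom_cast (eta a1 ⊗ eta2) eA eB = eta a).
{ intros eA eB; apply Arr_inj; rewrite Arr_comp_cast, Arr_hom_cast, Arr_tensm, Arr_phi.
  rewrite times_comp, i1_eta, i2_eta, times1l by typed; reflexivity. }
assert (phi21E : phi21 ≡ (mul a1 ⊗ id[B2]) ∘ (id[B1] ⊗ sigma) ∘ (phi21 ⊗ eta2)).
{ rewrite eq_castE; apply (acomp_cancel psi_phi); try typed.
  transitivity (« phi » ∙ ract (mul a1) sigma (« phi21 ») (« eta2 »)).
  - rewrite (phi_ract phi_sigma), phi_phi21, i2_eta, times1r by typed.
    reflexivity.
  - unfold ract, lact; to_arrows; reflexivity. }
exists {| cpa_phi21E := phi21E;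
          cpa_axioms := is_algebra_along_split_mono psi_phi
                          phi_mul (phi_eta _ _) |}.
repeat split; [exact phi_mul | apply phi_eta].
Qed.

End Factorization.

(** Applying [φ ψ = id] to the unit, with [ψ = (p1 ⊗ p2) d] and the unit grouplike
    for [d], gives [η = i1 p1 η • i2 p2 η = η • i2 p2 η]. *)
Lemma unit_of_complement (C : StrictBraidedCategory) (A B1 B2 : C)
    (a : algebra_on A) (a1 : algebra_on B1) (d : A ~> A ⊗ A)
    (i1 : B1 ~> A) (p1 : A ~> B1) (i2 : B2 ~> A) (p2 : A ~> B2) :
  i1 ∘ eta a1 = eta a -> p1 ∘ i1 = id[B1] ->
  d ∘ eta a ≡ eta a ⊗ eta a ->
  (mul a ∘ (i1 ⊗ i2)) ∘ ((p1 ⊗ p2) ∘ d) = id[A] ->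
  i2 ∘ (p2 ∘ eta a) = eta a.
Proof.
intros ie pi de e; apply Arr_inj.
apply (f_equal (@Arr C _ _)) in ie, pi, e.
to_arrows_in ie; to_arrows_in pi; to_arrows_in de; to_arrows_in e; to_arrows.
assert (pe : « p1 » ∙ « eta a » = « eta a1 »)
  by (rewrite <- ie, acompA, pi, acomp_idl by typed; reflexivity).
transitivity (« id[A] » ∙ « eta a »); [| now rewrite acomp_idl by typed].
rewrite <- e, <- !acompA, de, !atens_comp, pe, ie by typed.
change (« i2 » ∙ (« p2 » ∙ « eta a »)
  = « eta a » •[a] (« i2 » ∙ (« p2 » ∙ « eta a »))).
rewrite times1l by typed; reflexivity.
Qed.

(** * From a cross product algebra to a factorization *)

Section CrossProductFactors.
Context {C : StrictBraidedCategory} {B1 B2 : C} (X : CrossProductAlgebra B1 B2).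

Notation a1 := (cpa_alg1 X).
Notation eta2 := (cpa_unit2 X).
Notation phi21 := (cpa_phi21 X).
Notation sigma := (cpa_sigma X).

Notation "f ▷ g" := (lact B2 (mul a1) f g) (at level 46, right associativity).
Notation "g ◁ h" := (ract (mul a1) sigma g h) (at level 45, left associativity).

Definition cross_in1 : B1 ~> B1 ⊗ B2 := ⌜ id[B1] ⊗ eta2 ⌝.
Definition cross_in2 : B2 ~> B1 ⊗ B2 := ⌜ eta a1 ⊗ id[B2] ⌝.

Lemma Arr_cross_mul :
  « mul (cross_algebra X) » = « id[B1] » ▷ (« phi21 » ◁ « id[B2] »).
Proof. apply cross_mulE. Qed.

Lemma Arr_cross_eta : « eta (cross_algebra X) » = « eta a1 » ⊠ « eta2 ».
Proof. apply Arr_hom_cast. Qed.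

Lemma cross_mul_comp (f1 f2 f3 f4 : arrow C) :
  tgt f1 = B1 -> tgt f2 = B2 -> tgt f3 = B1 -> tgt f4 = B2 ->
  « mul (cross_algebra X) » ∙ ((f1 ⊠ f2) ⊠ (f3 ⊠ f4))
    = f1 ▷ ((« phi21 » ∙ (f2 ⊠ f3)) ◁ f4).
Proof.
intros e1 e2 e3 e4.
rewrite Arr_cross_mul, atensA, <- (atensA f1), <- (atensA f1).
rewrite lact_comp, ract_comp, !acomp_idl by typed; reflexivity.
Qed.

(** The left unit law says that multiplying [φ21 (η2 ⊗ id)] by [B2] on the right
    gives the identity.  On [η2] this gives [id ⊗ η2], while by the normalization
    of [φ21] right multiplication by [η2] leaves [φ21 (η2 ⊗ id)] unchanged. *)
Lemma phi21_unit : « phi21 » ∙ (« eta2 » ⊠ « id[B1] ») = « id[B1] » ⊠ « eta2 ».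
Proof.
pose proof (alg_unitl (algebra_axioms (cross_algebra X))) as e.
to_arrows_in e; rewrite Arr_cross_eta, <- atens_id, cross_mul_comp, lact1 in e by typed.
pose proof (cpa_phi21E X) as en; rewrite eq_castE in en.
assert (en' : « phi21 » = « phi21 » ◁ « eta2 »)
  by (rewrite en at 1; unfold ract, lact; to_arrows; reflexivity).
apply (f_equal (fun f => f ∙ (« id[B1] » ⊠ « eta2 »))) in e.
rewrite ract_comp, acomp_idl, acomp_idr, atens_comp, !acomp_idl in e by typed.
transitivity ((« phi21 » ◁ « eta2 ») ∙ (« eta2 » ⊠ « id[B1] » ⊠ « id[𝟙] »)).
- rewrite atens1r, <- en'; reflexivity.
- rewrite ract_comp, acomp_idr by typed; exact e.
Qed.

(** The left unit law again, now that [φ21 (η2 ⊗ id)] is known; in terms of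
    [sigma] it says that [η2] is a left unit. *)
Lemma ract_tens_unit (f h : arrow C) : tgt f = B1 -> tgt h = B2 ->
  (f ⊠ « eta2 ») ◁ h = f ⊠ h.
Proof.
intros fB hB.
pose proof (alg_unitl (algebra_axioms (cross_algebra X))) as e.
to_arrows_in e; rewrite Arr_cross_eta, <- atens_id, cross_mul_comp, lact1, phi21_unit in e by typed.
transitivity (« id[B1] » ⊠ « id[B2] » ∙ (f ⊠ h)).
- rewrite <- e, ract_comp, acomp_idl by typed.
  rewrite <- (atens1r f) at 2.
  rewrite atens_comp, acomp_idl, acomp_idr by typed; reflexivity.
- rewrite atens_comp, !acomp_idl by typed; reflexivity.
Qed.

Lemma cross_in1_algebra_morphism : algebra_morphism a1 (cross_algebra X) cross_in1.
Proof.
unfold cross_in1; split; apply Arr_inj; rewrite ?Arr_comp_cast, ?Arr_cross_eta; to_arrows.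
- rewrite cross_mul_comp, phi21_unit, ract_tens_unit, lact_tens by typed.
  rewrite <- (atens1r (« mul a1 »)).
  rewrite atens_comp, acomp_idl, acomp_idr by typed.
  unfold times; rewrite atens_id, acomp_idr by typed; reflexivity.
- rewrite <- (atens1r (« eta a1 »)) at 1.
  rewrite atens_comp, acomp_idl, acomp_idr by typed; reflexivity.
Qed.

Lemma cross_factorization :
  mul (cross_algebra X) ∘ (cross_in1 ⊗ cross_in2) = id[B1 ⊗ B2].
Proof.
unfold cross_in1, cross_in2; apply Arr_inj; to_arrows.
rewrite cross_mul_comp by typed.
assert (e : « phi21 » ∙ (« eta2 » ⊠ « eta a1 ») = « eta a1 » ⊠ « eta2 »).
{ transitivity (« phi21 » ∙ (« eta2 » ⊠ « id[B1] ») ∙ (« id[𝟙] » ⊠ « eta a1 »)).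
  - rewrite <- acompA, atens_comp, acomp_idl, acomp_idr by typed; reflexivity.
  - rewrite phi21_unit, atens1l, <- (atens1r (« eta a1 »)) at 1.
    rewrite atens_comp, acomp_idl, acomp_idr by typed; reflexivity. }
rewrite e, ract_tens_unit, lact_tens, times1r, atens_id by typed; reflexivity.
Qed.

End CrossProductFactors.

(** * Duality: reversing arrows and tensor factors *)

Definition op_category (C : Category) : Category.
Proof.
refine {| ob := C; hom := fun A B => B ~> A; idm := fun A => id[A];
          comp := fun A B D (g : D ~> B) (f : B ~> A) => comp f g |}.
- intros; apply comp_idr.
- intros; apply comp_idl.
- intros; symmetry; apply compA.
Defined.

Lemma Arr_op_hom_cast (C : Category) (A A' B B' : C) (f : B ~> A)
    (eA : A = A') (eB : B = B') :
  « @hom_cast (op_category C) A A' B B' f eA eB : B' ~> A' » = « f ».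
Proof. now destruct eA, eB. Qed.

(** The tensor factors are reversed together with the arrows because the cross
    product comultiplication splits [B2] first where the multiplication joins
    [B1] last: only the mirror image of the opposite category turns one formula
    into the other. *)
Definition oprev_monoidal (C : StrictMonoidalCategory) : StrictMonoidalCategory.
Proof.
refine {| smc_cat := op_category C;
          tens := fun A B : C => (B ⊗ A)%obj;
          tunit := (𝟙%obj : C);
          tensm := fun A A' B B' (f : @hom C A' A) (g : @hom C B' B) => g ⊗ f;
          tensA := fun A B D : C => eq_sym (tensA D B A);
          tens1l := fun A : C => tens1r A;
          tens1r := fun A : C => tens1l A |}.
- intros; apply tensm_id.
- intros; apply tensm_comp.
- intros; apply (@Arr_inj C); rewrite Arr_op_hom_cast, !Arr_tensm.
  symmetry; apply atensA.
- intros; apply (@Arr_inj C); rewrite Arr_op_hom_cast; exact (atens1r (@Arr C _ _ f)).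
- intros; apply (@Arr_inj C); rewrite Arr_op_hom_cast; exact (atens1l (@Arr C _ _ f)).
Defined.

Lemma Arr_op_comp_cast (C : Category) (A B B' D : C) (g : D ~> B')
    (f : B ~> A) (e : B = B') :
  « @comp_cast (op_category C) A B B' D g f e : D ~> A » = « f » ∙ « g ».
Proof. destruct e; exact (@Arr_comp C D B A f g). Qed.

Lemma op_eq_castE (C : Category) (A A' B B' : C) (f : B ~> A) (g : B' ~> A')
    (eA : A = A') (eB : B = B') :
  @eq_cast (op_category C) A A' B B' f g eA eB <-> « f » = « g ».
Proof.
unfold eq_cast; destruct eA, eB; simpl; split; [now intros -> | apply Arr_inj].
Qed.

Lemma Arr_op_tensm (C : StrictMonoidalCategory) (A A' B B' : C)
    (f : A' ~> A) (g : B' ~> B) :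
  @Arr C _ _ (@tensm (oprev_monoidal C) A A' B B' f g) = « g » ⊠ « f ».
Proof. reflexivity. Qed.

(** With source and target exchanged and tensor factors reversed, the braiding
    keeps its direction, and each hexagon yields the one of the same name. *)
Definition oprev (C : StrictBraidedCategory) : StrictBraidedCategory.
Proof.
refine {| sbc_cat := oprev_monoidal C;
          braid := fun A B => (braid A B : (A ⊗ B)%obj ~> (B ⊗ A)%obj) |}.
- intros A B; destruct (braid_iso A B) as [g [gf fg]]; exists g; split; [exact fg| exact gf].
- intros A A' B B' f g; symmetry; apply (@braid_nat C).
- intros A B D; apply op_eq_castE.
  pose proof (braid_tensr A D B : _) as e; to_arrows_in e.
  rewrite Arr_op_comp_cast, !Arr_op_tensm; exact e.
- intros A B D; apply op_eq_castE.
  pose proof (braid_tensl B A D : _) as e; to_arrows_in e.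
  rewrite Arr_op_comp_cast, !Arr_op_tensm; exact e.
Defined.

Lemma algebra_on_ext (C : StrictBraidedCategory) (A : C) (a a' : algebra_on A) :
  mul a = mul a' -> eta a = eta a' -> a = a'.
Proof.
destruct a as [m e ax], a' as [m' e' ax']; simpl; intros -> ->.
now rewrite (proof_irrelevance _ ax ax').
Qed.

Section Duality.
Context {C : StrictBraidedCategory}.

Ltac op_arrows :=
  repeat first [ rewrite (@op_eq_castE C) | rewrite (@Arr_op_hom_cast C)
               | rewrite (@Arr_op_comp_cast C) | rewrite (@Arr_op_tensm C) ].

Lemma Arr_cross_eps (B1 B2 : C) (X : CrossProductCoalgebra B1 B2) :
  « eps (cross_coalgebra X) » = « cpc_counit1 X » ⊠ « eps (cpc_coalg2 X) ».
Proof. apply Arr_hom_cast. Qed.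

Lemma is_algebra_oprev (A : C) (d : A ~> A ⊗ A) (e : A ~> 𝟙) :
  @is_algebra (oprev C) A d e <-> is_coalgebra d e.
Proof.
split; intros [assoc unitl unitr]; split.
- to_arrows; symmetry; revert assoc; op_arrows; easy.
- to_arrows; revert unitr; op_arrows; easy.
- to_arrows; revert unitl; op_arrows; easy.
- op_arrows; symmetry; revert assoc; to_arrows; easy.
- op_arrows; revert unitr; to_arrows; easy.
- op_arrows; revert unitl; to_arrows; easy.
Qed.

Definition op_algebra (A : C) (c : coalgebra_on A) : @algebra_on (oprev C) A :=
  @Build_algebra_on (oprev C) A (comul c) (eps c)
    (proj2 (is_algebra_oprev _ _) (coalgebra_axioms c)).

Definition op_coalgebra (A : C) (a : @algebra_on (oprev C) A) : coalgebra_on A :=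
  {| coalgebra_axioms := proj1 (is_algebra_oprev (mul a) (eta a)) (algebra_axioms a) |}.

Lemma cross_mul_oprev (B1 B2 : C) (d : B2 ~> B2 ⊗ B2) (phi : B1 ⊗ B2 ~> B2 ⊗ B1)
    (rho : B1 ⊗ B2 ~> B1 ⊗ B1) :
  @cross_mul (oprev C) B2 B1 d phi rho = cross_comul d phi rho.
Proof.
apply (@Arr_inj C); unfold cross_mul, cross_comul; op_arrows; to_arrows.
rewrite acompA, atensA by typed; reflexivity.
Qed.

Lemma cross_unit_oprev (B1 B2 : C) (e1 : B1 ~> 𝟙) (e2 : B2 ~> 𝟙) eA eB eA' eB' :
  @hom_cast (oprev C) (𝟙 ⊗ 𝟙)%obj 𝟙%obj (B1 ⊗ B2)%obj (B1 ⊗ B2)%obj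
    (e1 ⊗ e2) eA eB
  = @hom_cast C (B1 ⊗ B2)%obj (B1 ⊗ B2)%obj (𝟙 ⊗ 𝟙)%obj 𝟙%obj (e1 ⊗ e2) eA' eB'.
Proof. apply (@Arr_inj C); op_arrows; to_arrows; reflexivity. Qed.

Lemma cross_axioms_oprev (B1 B2 : C) (d : B2 ~> B2 ⊗ B2)
    (phi : B1 ⊗ B2 ~> B2 ⊗ B1) (rho : B1 ⊗ B2 ~> B1 ⊗ B1)
    (e1 : B1 ~> 𝟙) (e2 : B2 ~> 𝟙) eA eB eA' eB' :
  @is_algebra (oprev C) (B1 ⊗ B2)%obj (@cross_mul (oprev C) B2 B1 d phi rho)
    (@hom_cast (oprev C) (𝟙 ⊗ 𝟙)%obj 𝟙%obj (B1 ⊗ B2)%obj (B1 ⊗ B2)%obj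
       (e1 ⊗ e2) eA eB)
  <-> is_coalgebra (cross_comul d phi rho)
        (@hom_cast C (B1 ⊗ B2)%obj (B1 ⊗ B2)%obj (𝟙 ⊗ 𝟙)%obj 𝟙%obj
           (e1 ⊗ e2) eA' eB').
Proof.
rewrite (cross_unit_oprev _ _ _ _ eA' eB'), cross_mul_oprev.
apply is_algebra_oprev.
Qed.

Definition op_cross_product (B1 B2 : C) (X : CrossProductCoalgebra B1 B2) :
  @CrossProductAlgebra (oprev C) B2 B1.
Proof.
refine (@Build_CrossProductAlgebra (oprev C) B2 B1 (op_algebra (cpc_coalg2 X))
  (cpc_counit1 X) (cpc_phi12 X) (cpc_rho X) _ _).
- pose proof (cpc_phi12E X) as e; to_arrows_in e.
  op_arrows; rewrite acompA by typed; exact e.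
- exact (proj2 (cross_axioms_oprev _ _ _ _ _ _ _ _ _) (cpc_axioms X)).
Defined.

(** Inverse to [op_cross_product] on the data: that one carries a given coalgebra
    into the reversed category, this one brings a construction made there back. *)
Definition cross_coalgebra_of_op (B1 B2 : C)
  (X : @CrossProductAlgebra (oprev C) B2 B1) : CrossProductCoalgebra B1 B2.
Proof.
refine (@Build_CrossProductCoalgebra C B1 B2 (op_coalgebra (cpa_alg1 X))
  (cpa_unit2 X) (cpa_phi21 X) (cpa_sigma X) _ _).
- to_arrows; rewrite <- acompA by typed.
  pose proof (cpa_phi21E X) as e; revert e; op_arrows; easy.
- exact (proj1 (cross_axioms_oprev _ _ _ _ _ _ _ _ _) (cpa_axioms X)).
Defined.

Lemma op_algebra_morphism (A A' : C) (c : coalgebra_on A) (c' : coalgebra_on A')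
    (f : A ~> A') :
  coalgebra_morphism c c' f <->
  @algebra_morphism (oprev C) A' A (op_algebra c') (op_algebra c) f.
Proof. split; intros [fd fe]; split; first [exact fe | symmetry; exact fd]. Qed.

Lemma cross_algebra_op_cross_product (B1 B2 : C) (X : CrossProductCoalgebra B1 B2) :
  cross_algebra (op_cross_product X) = op_algebra (cross_coalgebra X).
Proof.
apply (@algebra_on_ext (oprev C)); [apply cross_mul_oprev | apply cross_unit_oprev].
Qed.

Lemma op_cross_coalgebra_of_op (B1 B2 : C) (X : @CrossProductAlgebra (oprev C) B2 B1) :
  op_algebra (cross_coalgebra (cross_coalgebra_of_op X)) = cross_algebra X.
Proof.
apply (@algebra_on_ext (oprev C)); symmetry;
  [apply cross_mul_oprev | apply cross_unit_oprev].
Qed.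

End Duality.

(** * Transport along isomorphisms *)

Section Transport.
Context {C : StrictBraidedCategory}.

Lemma algebra_morphism_comp (A A' A'' : C) (a : algebra_on A) (a' : algebra_on A')
    (a'' : algebra_on A'') (f : A ~> A') (g : A' ~> A'') :
  algebra_morphism a a' f -> algebra_morphism a' a'' g ->
  algebra_morphism a a'' (g ∘ f).
Proof.
intros [fm fe] [gm ge].
rewrite ArrE in fm, fe, gm, ge; to_arrows_in fm; to_arrows_in fe;
  to_arrows_in gm; to_arrows_in ge.
split; rewrite ArrE; to_arrows.
- rewrite <- acompA, fm, acompA, gm, <- acompA, atens_comp by typed; reflexivity.
- rewrite <- acompA, fe by typed; exact ge.
Qed.

Lemma algebra_morphism_inv (A A' : C) (a : algebra_on A) (a' : algebra_on A')
    (f : A ~> A') (g : A' ~> A) :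
  inverse_morphisms f g -> algebra_morphism a a' f -> algebra_morphism a' a g.
Proof.
intros fg [fm fe]; pose proof fg as [gf fg']; pose proof gf as gf0.
rewrite ArrE in fm, fe, gf, fg'; to_arrows_in fm; to_arrows_in fe;
  to_arrows_in gf; to_arrows_in fg'.
split; rewrite ArrE; to_arrows; apply (acomp_cancel gf0); try typed.
- rewrite !acompA, fm, fg', <- acompA, atens_comp, fg', atens_id by typed.
  rewrite acomp_idl, acomp_idr by typed; reflexivity.
- rewrite acompA, fg', acomp_idl by typed; now symmetry.
Qed.

End Transport.

Section CoalgebraTransport.
Context {C : StrictBraidedCategory}.

Lemma coalgebra_morphism_comp (A A' A'' : C) (c : coalgebra_on A)
    (c' : coalgebra_on A') (c'' : coalgebra_on A'') (f : A ~> A') (g : A' ~> A'') :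
  coalgebra_morphism c c' f -> coalgebra_morphism c' c'' g ->
  coalgebra_morphism c c'' (g ∘ f).
Proof.
rewrite !op_algebra_morphism; intros hf hg.
exact (algebra_morphism_comp (C := oprev C) hg hf).
Qed.

Lemma coalgebra_morphism_inv (A A' : C) (c : coalgebra_on A) (c' : coalgebra_on A')
    (f : A ~> A') (g : A' ~> A) :
  inverse_morphisms f g -> coalgebra_morphism c c' f -> coalgebra_morphism c' c g.
Proof.
rewrite !op_algebra_morphism; intros [gf fg] hf.
refine (algebra_morphism_inv (C := oprev C) (f := f) _ hf).
split; [exact fg | exact gf].
Qed.

Lemma braid_middle_nat (A A' : C) (f : A' ~> A) :
  « id[A] ⊗ braid A A ⊗ id[A] » ∙ ((« f » ⊠ « f ») ⊠ (« f » ⊠ « f »))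
  = ((« f » ⊠ « f ») ⊠ (« f » ⊠ « f ») ∙ « id[A'] ⊗ braid A' A' ⊗ id[A'] »).
Proof.
pose proof (braid_nat f f) as bn; rewrite ArrE in bn; to_arrows_in bn; to_arrows.
rewrite atensA, <- (atensA (« f »)).
rewrite !atens_comp, bn, !acomp_idl, !acomp_idr by typed; reflexivity.
Qed.

(** Composed with [f ⊗ f] where they end in [A' ⊗ A'], and with the counit of [A']
    read as that of [A] after [f], the axioms become those of [A]; the braiding
    enters through its naturality. *)
Lemma is_bialgebra_along_iso (A A' : C) (a : algebra_on A) (c : coalgebra_on A)
    (a' : algebra_on A') (c' : coalgebra_on A') (f : A' ~> A) :
  is_iso f -> algebra_morphism a' a f -> coalgebra_morphism c' c f ->
  is_bialgebra a c -> is_bialgebra a' c'.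
Proof.
intros [g [gf fg]] [fm fe] [fd fe'] [dm de em ee].
assert (ggff : (g ⊗ g) ∘ (f ⊗ f) = id[A' ⊗ A']).
{ rewrite ArrE in gf |- *; to_arrows_in gf; to_arrows.
  rewrite atens_comp, gf, atens_id by typed; reflexivity. }
rewrite ArrE in fm, fe, fd, fe', dm, ee.
to_arrows_in fm; to_arrows_in fe; to_arrows_in fd; to_arrows_in fe';
  rewrite !Arr_comp_cast in dm; to_arrows_in de; to_arrows_in em; to_arrows_in ee.
split; rewrite ?ArrE; rewrite ?eq_castE, ?Arr_comp_cast.
- apply (acomp_cancel ggff); try typed.
  transitivity (« mul a ⊗ mul a » ∙ « id[A] ⊗ braid A A ⊗ id[A] »
    ∙ ((« f » ⊠ « f ») ⊠ (« f » ⊠ « f »)) ∙ « comul c' ⊗ comul c' »).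
  + rewrite acompA, (Arr_tensm f f), fd, <- acompA, fm, acompA, dm by typed.
    rewrite <- !acompA, !Arr_tensm, (atens_comp (f := « f »)) by typed.
    rewrite (atens_comp (f := « comul c' »)), fd by typed; reflexivity.
  + rewrite <- (acompA (h := « mul a ⊗ mul a »)), braid_middle_nat by typed.
    rewrite acompA, !Arr_tensm, (atens_comp (f := « f » ⊠ « f »)), <- fm by typed.
    rewrite <- (atens_comp (f := « mul a' »)), <- !acompA by typed; reflexivity.
- apply (acomp_cancel ggff); try typed.
  rewrite !Arr_tensm, acompA, fd, <- acompA, fe, de, atens_comp, fe by typed.
  reflexivity.
- rewrite Arr_tensm, <- fe', <- acompA, fm, acompA, em, atens_comp by typed.
  reflexivity.
- rewrite <- fe', <- acompA, fe by typed; exact ee.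
Qed.

End CoalgebraTransport.

(** * The equivalences *)

Definition idempotent_factorization (C : StrictBraidedCategory) (B : Bialgebra C) :=
  exists P1 P2 : B ~> B,
    (idempotent P1 /\ idempotent P2) /\
    (mul B ∘ (P1 ⊗ P1) = P1 ∘ mul B ∘ (P1 ⊗ P1) /\ P1 ∘ eta B = eta B) /\
    ((P2 ⊗ P2) ∘ comul B = (P2 ⊗ P2) ∘ comul B ∘ P2 /\
     eps B ∘ P2 = eps B) /\
    (idempotent (P1 ⊗ P2) /\
     is_splitting (mul B ∘ (P1 ⊗ P2)) ((P1 ⊗ P2) ∘ comul B) (P1 ⊗ P2)).

Definition split_factorization (C : StrictBraidedCategory) (B : Bialgebra C) :=
  exists (B1 B2 : C) (a1 : algebra_on B1) (c2 : coalgebra_on B2)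
      (i1 : B1 ~> B) (p1 : B ~> B1) (i2 : B2 ~> B) (p2 : B ~> B2),
    (algebra_morphism a1 B i1 /\ coalgebra_morphism B c2 p2) /\
    (p1 ∘ i1 = id[B1] /\ p2 ∘ i2 = id[B2]) /\
    inverse_morphisms (mul B ∘ (i1 ⊗ i2)) ((p1 ⊗ p2) ∘ comul B).

(** The maps [id ⊗ η2], [η1 ⊗ id] and their duals, carried to [B] along the
    isomorphism.  Normalization is what makes them sections and retractions; it
    gives [ε1 η1 = id], and [ε2 η2 = id] then follows from [ε η = id]. *)
Lemma split_factorization_of_cross_product (C : StrictBraidedCategory)
    (B : Bialgebra C) (X : CrossProductBialgebra C) :
  normalized X -> bialgebra_isomorphic B X -> split_factorization B.
Proof.
intros hn [f [[g fg] [fa fc]]]; pose proof fg as [gf fg'].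
pose proof (algebra_morphism_inv fg fa) as ga.
pose (i1 := cross_in1 (cpb_alg X)); pose (i2 := cross_in2 (cpb_alg X)).
pose (Y := op_cross_product (cpb_coalg X)).
pose (p2 := cross_in1 Y : cpb_ob1 X ⊗ cpb_ob2 X ~> cpb_ob2 X).
pose (p1 := cross_in2 Y : cpb_ob1 X ⊗ cpb_ob2 X ~> cpb_ob1 X).
assert (i1_mor : algebra_morphism (cpa_alg1 (cpb_alg X)) (cpb_bialgebra X) i1)
  by apply cross_in1_algebra_morphism.
assert (p2_mor : coalgebra_morphism (cpb_bialgebra X) (cpc_coalg2 (cpb_coalg X)) p2).
{ apply op_algebra_morphism.
  pose proof (cross_in1_algebra_morphism Y) as h.
  unfold Y in h; rewrite cross_algebra_op_cross_product in h; exact h. }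
assert (m12 : mul X ∘ (i1 ⊗ i2) = id[cpb_ob1 X ⊗ cpb_ob2 X])
  by apply cross_factorization.
assert (d12 : (p1 ⊗ p2) ∘ comul X = id[cpb_ob1 X ⊗ cpb_ob2 X]).
{ pose proof (cross_factorization Y) as h.
  unfold Y in h; rewrite cross_algebra_op_cross_product in h; exact h. }
assert (en1 : « cpc_counit1 (cpb_coalg X) » ∙ « eta (cpa_alg1 (cpb_alg X)) » = « id[𝟙] »)
  by (rewrite <- Arr_comp; now f_equal).
assert (en2 : « eps (cpc_coalg2 (cpb_coalg X)) » ∙ « cpa_unit2 (cpb_alg X) » = « id[𝟙] »).
{ pose proof (bialg_counit_unit (cpb_axioms X)) as e; rewrite ArrE in e.
  rewrite Arr_comp_cast, Arr_cross_eps, Arr_cross_eta, atens_comp, en1, atens1l in e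
    by typed; exact e. }
assert (pi1 : p1 ∘ i1 = id[cpb_ob1 X]).
{ unfold p1, i1, cross_in1, cross_in2; rewrite ArrE, Arr_comp_cast, Arr_hom_cast.
  rewrite (@Arr_op_hom_cast C), (@Arr_op_tensm C), Arr_tensm.
  change (« id[cpb_ob1 X] » ⊠ « eps (cpc_coalg2 (cpb_coalg X)) »
    ∙ (« id[cpb_ob1 X] » ⊠ « cpa_unit2 (cpb_alg X) ») = « id[cpb_ob1 X] »).
  rewrite atens_comp, en2, atens1r, acomp_idl by typed; reflexivity. }
assert (pi2 : p2 ∘ i2 = id[cpb_ob2 X]).
{ unfold p2, i2, cross_in1, cross_in2; rewrite ArrE, Arr_comp_cast, Arr_hom_cast.
  rewrite (@Arr_op_hom_cast C), (@Arr_op_tensm C), Arr_tensm.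
  change (« cpc_counit1 (cpb_coalg X) » ⊠ « id[cpb_ob2 X] »
    ∙ (« eta (cpa_alg1 (cpb_alg X)) » ⊠ « id[cpb_ob2 X] ») = « id[cpb_ob2 X] »).
  rewrite atens_comp, en1, atens1l, acomp_idl by typed; reflexivity. }
exists (cpb_ob1 X), (cpb_ob2 X), (cpa_alg1 (cpb_alg X)), (cpc_coalg2 (cpb_coalg X)),
  (g ∘ i1), (p1 ∘ f), (g ∘ i2), (p2 ∘ f).
split; [|split].
- exact (conj (algebra_morphism_comp i1_mor ga) (coalgebra_morphism_comp fc p2_mor)).
- rewrite ArrE in fg', pi1, pi2; to_arrows_in fg'; to_arrows_in pi1; to_arrows_in pi2.
  split; rewrite ArrE; to_arrows; rewrite acompA by typed;
    rewrite <- (acompA (g := « f »)), fg', acomp_idr by typed; assumption.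
- assert (em : mul B ∘ ((g ∘ i1) ⊗ (g ∘ i2)) = g).
  { destruct ga as [gm _]; rewrite ArrE in gm, m12 |- *.
    to_arrows_in gm; to_arrows_in m12; to_arrows.
    rewrite <- atens_comp, acompA, <- gm, <- acompA, m12, acomp_idr by typed.
    reflexivity. }
  assert (ed : ((p1 ∘ f) ⊗ (p2 ∘ f)) ∘ comul B = f).
  { destruct fc as [fd _]; rewrite ArrE in fd, d12 |- *.
    to_arrows_in fd; to_arrows_in d12; to_arrows.
    rewrite <- atens_comp, <- acompA, fd, acompA, d12, acomp_idl by typed.
    reflexivity. }
  rewrite em, ed; split; [exact fg'|exact gf].
Qed.

(** [φ = m (i1 ⊗ i2)] carries the algebra of [B] to a cross product algebra, and
    its inverse [ψ = (p1 ⊗ p2) Δ], seen in [oprev C], does the same for the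
    coalgebra; the bialgebra axioms come along with [φ]. *)
Lemma cross_product_of_split_factorization (C : StrictBraidedCategory)
    (B : Bialgebra C) :
  split_factorization B ->
  exists X : CrossProductBialgebra C, normalized X /\ bialgebra_isomorphic B X.
Proof.
intros (B1 & B2 & a1 & c2 & i1 & p1 & i2 & p2 & [i1_mor p2_mor] & [pi1 pi2] & inv).
pose (phi := mul B ∘ (i1 ⊗ i2)); pose (psi := (p1 ⊗ p2) ∘ comul B).
destruct (bialgebra_axioms B) as [_ de em ee].
destruct inv as [psi_phi phi_psi].
assert (i2_unit : i2 ∘ (p2 ∘ eta B) = eta B)
  by exact (unit_of_complement (proj2 i1_mor) pi1 de phi_psi).
destruct (cross_algebra_of_factorization (phi := phi) (proj1 i1_mor) (proj2 i1_mor)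
            eq_refl i2_unit) as (X & X1 & _ & X_mor).
{ exists psi; now split. }
assert (p1_counit : (eps B ∘ i1) ∘ p1 = eps B).
{ pose proof (proj1 (op_algebra_morphism _ _ _) p2_mor) as h.
  refine (unit_of_complement (C := oprev C) (a := op_algebra B) (d := mul B)
    (p2 := i1) (p1 := i2) (proj2 h) pi2 _ phi_psi).
  apply (@op_eq_castE C); rewrite eq_castE in em.
  rewrite (@Arr_op_comp_cast C); to_arrows_in em; exact em. }
destruct (cross_algebra_of_factorization (C := oprev C) (A := B) (B1 := B2) (B2 := B1)
  (a := op_algebra B) (a1 := op_algebra c2) (i1 := p2) (i2 := p1) (phi := psi)
  (proj1 (proj1 (op_algebra_morphism _ _ _) p2_mor))
  (proj2 (proj1 (op_algebra_morphism _ _ _) p2_mor))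
  eq_refl (eta2 := (eps B ∘ i1 : @hom C B1 𝟙%obj)) p1_counit) as (Y & _ & Y2 & Y_mor).
{ exists phi; split; [exact psi_phi | exact phi_psi]. }
rewrite <- op_cross_coalgebra_of_op in Y_mor; apply op_algebra_morphism in Y_mor.
assert (psi_phi_inv : inverse_morphisms psi phi) by now split.
assert (phi_iso : is_iso phi) by now exists psi.
pose proof (coalgebra_morphism_inv psi_phi_inv Y_mor) as phi_comor.
exists {| cpb_axioms := is_bialgebra_along_iso phi_iso X_mor phi_comor
                          (bialgebra_axioms B) |}.
split.
- unfold normalized; simpl; rewrite X1, Y2.
  destruct i1_mor as [_ i1_eta]; rewrite ArrE in i1_eta, ee |- *.
  to_arrows_in i1_eta; to_arrows_in ee; to_arrows.
  rewrite <- acompA, i1_eta by typed; exact ee.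
- exists psi; split; [now exists phi | split; [|exact Y_mor]].
  refine (algebra_morphism_inv _ X_mor); now split.
Qed.

(** Both conditions hold in any category: with [p i = id], the composite
    [(i p d) (m i p)] is [i x p] for [x = (p d) (m i)], and [x] is recovered from
    [i x p] as [p (i x p) i]. *)
Lemma splitting_iff_inverse (C : Category) (A B Y : C) (m : A ~> B) (d : B ~> A)
    (i : Y ~> A) (p : A ~> Y) :
  p ∘ i = id[Y] ->
  is_splitting (m ∘ (i ∘ p)) ((i ∘ p) ∘ d) (i ∘ p)
  <-> inverse_morphisms (m ∘ i) (p ∘ d).
Proof.
unfold is_splitting, inverse_morphisms, comp_cast; simpl; intros pi.
assert (e1 : comp (comp m (comp i p)) (comp (comp i p) d)
             = comp (comp m i) (comp p d)).
{ rewrite !compA; f_equal; rewrite <- (compA _ p i), pi, comp_idr; reflexivity. }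
assert (e2 : comp (comp (comp i p) d) (comp m (comp i p))
             = comp (comp i (comp (comp p d) (comp m i))) p)
  by now rewrite !compA.
rewrite e1, e2; split; intros [h1 h2].
- split; [|exact h1].
  apply (f_equal (fun z => comp p (comp z i))) in h2.
  rewrite <- !(compA _ p i), pi, !comp_idr in h2.
  rewrite !(compA p i), pi, !comp_idl in h2; exact h2.
- split; [exact h2|]; rewrite h1, comp_idr; reflexivity.
Qed.

(** The algebra structure on [A'] can only be [p m (i ⊗ i)] and [p η]; closedness
    of [i p] is what makes [i] respect it. *)
Lemma subalgebra_iff_closed (C : StrictBraidedCategory) (A A' : C)
    (a : algebra_on A) (i : A' ~> A) (p : A ~> A') :
  p ∘ i = id[A'] ->
  (exists a' : algebra_on A', algebra_morphism a' a i) <->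
  mul a ∘ ((i ∘ p) ⊗ (i ∘ p)) = (i ∘ p) ∘ mul a ∘ ((i ∘ p) ⊗ (i ∘ p))
  /\ (i ∘ p) ∘ eta a = eta a.
Proof.
intros pi; pose proof pi as pi'; rewrite ArrE in pi'; to_arrows_in pi'.
split.
- intros [a' [im ie]]; rewrite ArrE in im, ie; to_arrows_in im; to_arrows_in ie.
  split; rewrite ArrE; to_arrows.
  + rewrite <- !acompA, <- atens_comp, (acompA (h := « mul a »)), <- im by typed.
    rewrite <- !acompA, (acompA (h := « p »)), pi', acomp_idl by typed; reflexivity.
  + rewrite <- ie, <- acompA, (acompA (h := « p »)), pi', acomp_idl by typed.
    reflexivity.
- intros [em ee]; rewrite ArrE in em, ee; to_arrows_in em; to_arrows_in ee.
  pose (m' := p ∘ (mul a ∘ (i ⊗ i))); pose (e' := p ∘ eta a).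
  assert (im : i ∘ m' = mul a ∘ (i ⊗ i)).
  { rewrite ArrE; unfold m'; to_arrows.
    apply (f_equal (fun f => f ∙ (« i » ⊠ « i »))) in em.
    rewrite <- !acompA, !atens_comp in em by typed.
    rewrite <- !acompA, pi', acomp_idr in em by typed.
    symmetry; exact em. }
  assert (ie : i ∘ e' = eta a)
    by (rewrite ArrE; unfold e'; to_arrows; rewrite acompA by typed; exact ee).
  exists {| algebra_axioms := is_algebra_along_split_mono pi im ie |}.
  split; assumption.
Qed.

Lemma quotient_coalgebra_iff_closed (C : StrictBraidedCategory) (A A' : C)
    (c : coalgebra_on A) (i : A' ~> A) (p : A ~> A') :
  p ∘ i = id[A'] ->
  (exists c' : coalgebra_on A', coalgebra_morphism c c' p) <->
  ((i ∘ p) ⊗ (i ∘ p)) ∘ comul c = ((i ∘ p) ⊗ (i ∘ p)) ∘ comul c ∘ (i ∘ p)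
  /\ eps c ∘ (i ∘ p) = eps c.
Proof.
intros pi.
pose proof (subalgebra_iff_closed (C := oprev C) (op_algebra c) (i := p) (p := i) pi) as h.
unfold comp_cast in *; simpl in *.
rewrite <- compA, <- h; split.
- intros [c' hc]; exists (op_algebra c'); apply op_algebra_morphism; exact hc.
- intros [a' ha]; exists (op_coalgebra a'); apply op_algebra_morphism; exact ha.
Qed.

Lemma idempotent_iff_split_factorization (C : StrictBraidedCategory)
    (B : Bialgebra C) :
  idempotents_split C -> idempotent_factorization B <-> split_factorization B.
Proof.
intros hC.
assert (tens_split : forall (B1 B2 : C) (i1 : B1 ~> B) (p1 : B ~> B1)
  (i2 : B2 ~> B) (p2 : B ~> B2),
  p1 ∘ i1 = id[B1] -> p2 ∘ i2 = id[B2] ->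
  (p1 ⊗ p2) ∘ (i1 ⊗ i2) = id[B1 ⊗ B2]
  /\ (i1 ∘ p1) ⊗ (i2 ∘ p2) = (i1 ⊗ i2) ∘ (p1 ⊗ p2)).
{ unfold comp_cast; simpl; intros B1 B2 i1 p1 i2 p2 pi1 pi2.
  now rewrite <- !tensm_comp, pi1, pi2, tensm_id. }
assert (idem : forall (A Y : C) (i : Y ~> A) (p : A ~> Y), p ∘ i = id[Y] ->
  idempotent (i ∘ p)).
{ unfold idempotent, comp_cast; simpl; intros A Y i p pi.
  now rewrite compA, <- (compA i p i), pi, comp_idr. }
split.
- intros (P1 & P2 & [id1 id2] & alg1 & coalg2 & _ & spl).
  destruct (hC _ _ id1) as (B1 & p1 & i1 & [pi1 ip1]).
  destruct (hC _ _ id2) as (B2 & p2 & i2 & [pi2 ip2]).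
  subst P1 P2.
  destruct (tens_split _ _ _ _ _ _ pi1 pi2) as [pi12 e12].
  destruct (proj2 (subalgebra_iff_closed _ pi1) alg1) as [a1 i1_mor].
  destruct (proj2 (quotient_coalgebra_iff_closed _ pi2) coalg2) as [c2 p2_mor].
  rewrite e12 in spl; apply (splitting_iff_inverse _ _ pi12) in spl.
  now exists B1, B2, a1, c2, i1, p1, i2, p2.
- intros (B1 & B2 & a1 & c2 & i1 & p1 & i2 & p2 & [i1_mor p2_mor] & [pi1 pi2] & inv).
  destruct (tens_split _ _ _ _ _ _ pi1 pi2) as [pi12 e12].
  exists (i1 ∘ p1), (i2 ∘ p2).
  split; [split; now apply idem|].
  split; [apply (subalgebra_iff_closed _ pi1); now exists a1|].
  split; [apply (quotient_coalgebra_iff_closed _ pi2); now exists c2|].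
  rewrite e12; split; [now apply idem|].
  apply (splitting_iff_inverse _ _ pi12); exact inv.
Qed.

Theorem theorem3p2 (C : StrictBraidedCategory) (hC : idempotents_split C)
    (B : Bialgebra C) :
  let cond1 :=
    exists X : CrossProductBialgebra C,
      normalized X /\ bialgebra_isomorphic B X in
  let cond2 :=
    exists P1 P2 : B ~> B,
      (idempotent P1 /\ idempotent P2) /\
      (mul B ∘ (P1 ⊗ P1) = P1 ∘ mul B ∘ (P1 ⊗ P1) /\ P1 ∘ eta B = eta B) /\
      ((P2 ⊗ P2) ∘ comul B = (P2 ⊗ P2) ∘ comul B ∘ P2 /\
       eps B ∘ P2 = eps B) /\
      (idempotent (P1 ⊗ P2) /\
       is_splitting (mul B ∘ (P1 ⊗ P2)) ((P1 ⊗ P2) ∘ comul B) (P1 ⊗ P2)) in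
  let cond3 :=
    exists (B1 B2 : C) (a1 : algebra_on B1) (c2 : coalgebra_on B2)
        (i1 : B1 ~> B) (p1 : B ~> B1) (i2 : B2 ~> B) (p2 : B ~> B2),
      (algebra_morphism a1 B i1 /\ coalgebra_morphism B c2 p2) /\
      (p1 ∘ i1 = id[B1] /\ p2 ∘ i2 = id[B2]) /\
      inverse_morphisms (mul B ∘ (i1 ⊗ i2)) ((p1 ⊗ p2) ∘ comul B) in
  (cond1 <-> cond2) /\ (cond2 <-> cond3).
Proof.
intros cond1 cond2 cond3.
pose proof (idempotent_iff_split_factorization B hC) as h23.
split; [|exact h23].
split; intros h.
- destruct h as [X [hX hB]].
  exact (proj2 h23 (split_factorization_of_cross_product hX hB)).
- exact (cross_product_of_split_factorization (proj1 h23 h)).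
Qed.
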